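(* Let $\mathcal{O}$ be an order in an imaginary quadratic field with discriminant $\Delta$, and suppose $|\Delta|>12$. Then $\mathrm{PE}_2(\mathcal{O})$ is an infinite-index subgroup of $\mathrm{PSL}_2(\mathcal{O})$. Furthermore, $\mathrm{PE}_2(\mathcal{O})$ is its own normalizer in $\mathrm{PSL}_2(\mathcal{O})$.
   Context: $\mathrm{PE}_2(\mathcal{O})$, the projective elementary group, is the subgroup of $\mathrm{PSL}_2(\mathcal{O})$ generated by the (classes of) elementary matrices, i.e. the diagonal, (upper or lower) triangular, or permutation matrices in $\mathrm{PSL}_2(\mathcal{O})$; the permutation-type matrix is $\begin{bmatrix}0&-1\\1&0\end{bmatrix}$. The order $\mathcal{O}$ is not assumed to be maximal. *)

(* Defs.v *)
From HB Require Import structures.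
From mathcomp Require Import all_boot all_order all_algebra all_field.
From mathcomp Require Import mathcomp_extra boolp classical_sets functions cardinality.

Set Implicit Arguments.
Unset Strict Implicit.
Unset Printing Implicit Defensive.

Import Order.TTheory GRing.Theory Num.Theory.
Local Open Scope classical_set_scope.
Local Open Scope quotient_scope.
Local Open Scope ring_scope.

Section Subgroups.
Variable G : groupType.
Implicit Types (S H : set G) (g : G).

Definition is_subgroup H : Prop :=
  [/\ H 1%g, forall x y, H x -> H y -> H (x * y)%g & forall x, H x -> H (x^-1)%g].

Definition generated S : set G := smallest is_subgroup S.

Definition left_cosets H : set (set G) :=
  [set [set (g * h)%g | h in H] | g in [set: G]].

Definition infinite_index H : Prop := infinite_set (left_cosets H).

Definition normalizer H : set G :=
  [set g | [set (g * h * g^-1)%g | h in H] = H].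

Lemma generated_subgroup S : is_subgroup (generated S).
Proof.
split=> [M [[M1 _ _] _] // | x y Sx Sy M SM | x Sx M SM].
  by have [[_ MM _] _] := SM; apply: MM; [apply: Sx | apply: Sy].
by have [[_ _ MV] _] := SM; apply: MV; apply: Sx.
Qed.

End Subgroups.

(* Stated over a ring that need not have decidable units, as is the case of an
   order of a number field; the inverse is given by the adjugate. *)
Section SL2.
Variable R : comNzRingType.

Definition SL2 := {A : 'M[R]_2 | \det A == 1}.
HB.instance Definition _ := SubType.on SL2.
HB.instance Definition _ := Choice.on SL2.

Lemma SL2_det (A : SL2) : \det (val A) = 1. Proof. exact/eqP/(valP A). Qed.

Fact SL2_one_subproof : \det (1%:M : 'M[R]_2) == 1.
Proof. by rewrite det1. Qed.
Definition SL2_one : SL2 := Sub 1%:M SL2_one_subproof.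

Fact SL2_mul_subproof (A B : SL2) : \det (val A *m val B) == 1.
Proof. by rewrite det_mulmx !SL2_det mulr1. Qed.
Definition SL2_mul (A B : SL2) : SL2 := Sub (val A *m val B) (SL2_mul_subproof A B).

Fact SL2_inv_subproof (A : SL2) : \det (\adj (val A)) == 1.
Proof.
apply/eqP; have := congr1 determinant (mul_mx_adj (val A)).
by rewrite det_mulmx SL2_det mul1r det1.
Qed.
Definition SL2_inv (A : SL2) : SL2 := Sub (\adj (val A)) (SL2_inv_subproof A).

Fact SL2_mulA : associative SL2_mul.
Proof. by move=> A B C; apply/val_inj; rewrite /= mulmxA. Qed.
Fact SL2_mul1 : left_id SL2_one SL2_mul.
Proof. by move=> A; apply/val_inj; rewrite /= mul1mx. Qed.
Fact SL2_mulr1 : right_id SL2_one SL2_mul.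
Proof. by move=> A; apply/val_inj; rewrite /= mulmx1. Qed.
Fact SL2_mulV : left_inverse SL2_one SL2_inv SL2_mul.
Proof. by move=> A; apply/val_inj; rewrite /= mul_adj_mx SL2_det. Qed.
Fact SL2_mulrV : right_inverse SL2_one SL2_inv SL2_mul.
Proof. by move=> A; apply/val_inj; rewrite /= mul_mx_adj SL2_det. Qed.

HB.instance Definition _ := isGroup.Build SL2
  SL2_mulA SL2_mul1 SL2_mulr1 SL2_mulV SL2_mulrV.

Definition eq_up_to_sign (A B : SL2) : bool :=
  (val A == val B) || (val A == - val B).

Fact eq_up_to_sign_refl : reflexive eq_up_to_sign.
Proof. by move=> A; rewrite /eq_up_to_sign eqxx. Qed.
Fact eq_up_to_sign_sym : symmetric eq_up_to_sign.
Proof.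
by move=> A B; rewrite /eq_up_to_sign -[val A == - _]eqr_oppLR
  [val A == _]eq_sym [- val A == _]eq_sym.
Qed.
Fact eq_up_to_sign_trans : transitive eq_up_to_sign.
Proof.
move=> B A C; rewrite /eq_up_to_sign.
by case/orP=> /eqP-> /orP[]/eqP->; rewrite ?opprK eqxx ?orbT.
Qed.

Canonical eq_up_to_sign_equiv :=
  EquivRel eq_up_to_sign eq_up_to_sign_refl eq_up_to_sign_sym eq_up_to_sign_trans.

Definition PSL2 := {eq_quot eq_up_to_sign}.
HB.instance Definition _ := Choice.on PSL2.
HB.instance Definition _ := EqQuotient.on PSL2.

Definition class_of (A : SL2) : PSL2 := \pi_PSL2 A.

Lemma class_ofP (A B : SL2) :
  class_of A = class_of B <-> val A = val B \/ val A = - val B.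
Proof.
have E : (class_of A == class_of B) = eq_up_to_sign A B.
  exact: (eqmodE eq_up_to_sign_equiv A B).
split=> [/eqP|H]; last (apply/eqP; move: H); rewrite E /eq_up_to_sign.
  by case/orP=> /eqP; [left | right].
by case=> ->; rewrite eqxx ?orbT.
Qed.

Lemma repr_class (x : PSL2) : class_of (repr x) = x.
Proof. exact: reprK. Qed.

Definition PSL2_one : PSL2 := class_of 1%g.
Definition PSL2_mul (x y : PSL2) : PSL2 := class_of (repr x * repr y)%g.
Definition PSL2_inv (x : PSL2) : PSL2 := class_of (repr x)^-1%g.

Lemma PSL2_mulE (A B : SL2) :
  PSL2_mul (class_of A) (class_of B) = class_of (A * B)%g.
Proof.
apply/class_ofP; have /class_ofP := repr_class (class_of A).
have /class_ofP := repr_class (class_of B).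
change (val (?x * ?y)%g) with (val x *m val y).
by case=> -> [] ->; rewrite ?mulmxN ?mulNmx ?opprK; auto.
Qed.

Lemma PSL2_invE (A : SL2) : PSL2_inv (class_of A) = class_of A^-1%g.
Proof.
set B := repr (class_of A).
have /class_ofP HB := repr_class (class_of A); rewrite -/B in HB.
have E (C : SL2) : val C^-1%g = val C^-1%g *m val A *m val A^-1%g.
  by rewrite -[X in _ = val X *m _ *m _]/(C^-1)%g -mulmxA
    -[val A *m _]/(val (A * A^-1)%g) mulgV /= mulmx1.
apply/class_ofP; rewrite E -/B.
case: HB => HBA; [left | right].
  have -> : val A = val B by [].
  by rewrite -[val B^-1%g *m _]/(val (B^-1 * B)%g) mulVg /= mul1mx.
have -> : val A = - val B by rewrite HBA opprK.
by rewrite mulmxN -[val B^-1%g *m _]/(val (B^-1 * B)%g) mulVg /= mulNmx mul1mx.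
Qed.

Fact PSL2_mulA : associative PSL2_mul.
Proof.
move=> x y z; rewrite -[x]repr_class -[y]repr_class -[z]repr_class.
by rewrite !PSL2_mulE mulgA.
Qed.
Fact PSL2_mul1 : left_id PSL2_one PSL2_mul.
Proof. by move=> x; rewrite -[x]repr_class PSL2_mulE mul1g. Qed.
Fact PSL2_mulr1 : right_id PSL2_one PSL2_mul.
Proof. by move=> x; rewrite -[x]repr_class PSL2_mulE mulg1. Qed.
Fact PSL2_mulV : left_inverse PSL2_one PSL2_inv PSL2_mul.
Proof. by move=> x; rewrite -[x]repr_class PSL2_invE PSL2_mulE mulVg. Qed.
Fact PSL2_mulrV : right_inverse PSL2_one PSL2_inv PSL2_mul.
Proof. by move=> x; rewrite -[x]repr_class PSL2_invE PSL2_mulE mulgV. Qed.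

HB.instance Definition _ := isGroup.Build PSL2
  PSL2_mulA PSL2_mul1 PSL2_mulr1 PSL2_mulV PSL2_mulrV.

(* [[0, -1], [1, 0]] *)
Definition swap_mx : 'M[R]_2 :=
  \matrix_(i, j) if i == j then 0 else if (i : nat) == 0%N then -1 else 1.

(* [is_trig_mx] means lower triangular. *)
Definition elementary_mx (A : 'M[R]_2) : bool :=
  [|| is_diag_mx A, is_trig_mx A, is_trig_mx A^T | A == swap_mx].

Definition PE2 : set PSL2 :=
  generated [set class_of A | A in [set A : SL2 | elementary_mx (val A)]].

End SL2.

Section Orders.
Variable K : fieldExtType rat.

Definition imaginary_quadratic : Prop :=
  exists (d : int) (w : K),
    [/\ d < 0, w ^+ 2 = d%:~R & <<1%VS; w>>%VS = fullv].

Definition field_trace (x : K) : rat :=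
  \tr (passmx.mxof (vbasis {:K}) (vbasis {:K}) (amull x)).

Definition is_Zbasis (O : {pred K}) (b : (\dim {:K}).-tuple K) : Prop :=
  basis_of {:K} b /\
  (forall x, x \in O <-> exists c : 'I_(\dim {:K}) -> int,
                           x = \sum_i tnth b i *~ c i).

(* A subring is an order when it is a Z-lattice of full rank in K. *)
Definition is_order (O : subringClosed K) : Prop := exists b, is_Zbasis O b.

Definition basis_disc (b : (\dim {:K}).-tuple K) : rat :=
  \det (\matrix_(i, j) field_trace (tnth b i * tnth b j)).

Definition has_disc (O : subringClosed K) (Delta : rat) : Prop :=
  exists b, is_Zbasis O b /\ Delta = basis_disc b.

Definition order_ring (O : subringClosed K) := {x : K | x \in O}.

Section OrderRing.
Variable O : subringClosed K.
HB.instance Definition _ := SubType.on (order_ring O).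
HB.instance Definition _ := Choice.on (order_ring O).
HB.instance Definition _ := [SubChoice_isSubComNzRing of order_ring O by <:].
End OrderRing.

End Orders.

(* Main.v *)
(* The group generated by SL2(Z) and the translations by O acts on P^1(K), and
   |Delta| > 12 says exactly that every element of O outside Z has norm at
   least 4.  Hence the unit disks centred at Z and their translates by
   elements of O outside Z have disjoint interiors, and a ping-pong argument
   for the amalgam PSL2(Z) *_Z O shows that the E2-orbit of infinity lies in
   {infinity} and the union of the closed unit disks centred at O.

   Let h be in SL2(O) with h(infinity) = a/c; multiplying h by elements of E2
   makes N(c) minimal, so either c = 0 and h is in E2, or a/c lies in no open
   unit disk centred at O.  In the second case, for an integer x with
   |x| >= 3, one of the conjugates of the translations by x and -x by h sends
   infinity to a/c -+ 1/(c^2 x), outside all closed unit disks.  So if such a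
   conjugate is in PE2, then h is in PE2.  This gives the normalizer at once;
   and if h is not in PE2, no power of the conjugate by h of the translation by
   3 is in PE2, which therefore has infinite index.  Finally PE2 is a proper
   subgroup because some a/c, with a and c comaximal, is outside all the disks. *)
Require Import Defs.
From mathcomp Require Import all_boot all_order all_algebra all_field.
From mathcomp Require Import mathcomp_extra boolp classical_sets functions cardinality.
From mathcomp Require Import zify ring lra realalg.
Set Implicit Arguments.
Unset Strict Implicit.
Unset Printing Implicit Defensive.
Import Order.TTheory GRing.Theory Num.Theory.
Local Open Scope ring_scope.

(** * The ring Z[tau] and its norm form *)

Section QuadraticRing.
Variables (R : comNzRingType) (tau : R) (t n : int).

Definition quad (X Y : int) : R := X%:~R + Y%:~R * tau.

(** [tau] is a root of X^2 - t X + n, and 1, [tau] is a Z-basis; the last conjunct says that the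
    discriminant t^2 - 4 n is below -12. *)
Definition quadratic_ring : Prop :=
  [/\ tau ^+ 2 = quad (- n) t,
      forall x, exists X Y, x = quad X Y,
      forall X Y, quad X Y = 0 -> X = 0 /\ Y = 0
    & 12 < 4 * n - t ^+ 2].

Hypothesis qR : quadratic_ring.

Let tau_sq : tau ^+ 2 = quad (- n) t. Proof. by case: qR. Qed.
Let disc_gt : 12 < 4 * n - t ^+ 2. Proof. by case: qR. Qed.

Lemma quad_surj x : exists p, x = quad p.1 p.2.
Proof. by case: qR => _ /(_ x)[X [Y ->]] _ _; exists (X, Y). Qed.

(** Coordinates in the basis 1, [tau], not real and imaginary parts: the conjugate of [tau] is t -
    [tau]. *)
Definition re x := (sval (cid (quad_surj x))).1.
Definition im x := (sval (cid (quad_surj x))).2.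

Lemma quadE x : x = quad (re x) (im x).
Proof. exact: (svalP (cid (quad_surj x))). Qed.

Lemma quadB X Y X' Y' : quad X Y - quad X' Y' = quad (X - X') (Y - Y').
Proof. by rewrite /quad; ring. Qed.

Lemma quad_inj X Y X' Y' : quad X Y = quad X' Y' -> X = X' /\ Y = Y'.
Proof.
move/eqP; rewrite -subr_eq0 quadB => /eqP.
by case: qR => _ _ fr _ /fr[/eqP + /eqP]; rewrite !subr_eq0 => /eqP-> /eqP->.
Qed.

Lemma re_quad X Y : re (quad X Y) = X.
Proof. by have /quad_inj[] := quadE (quad X Y). Qed.

Lemma im_quad X Y : im (quad X Y) = Y.
Proof. by have /quad_inj[] := quadE (quad X Y). Qed.

Definition nm x : int := re x ^+ 2 + t * re x * im x + n * im x ^+ 2.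
Definition tr x : int := 2 * re x + t * im x.
Definition conjq x : R := quad (re x + t * im x) (- im x).

Lemma nm_quad X Y : nm (quad X Y) = X ^+ 2 + t * X * Y + n * Y ^+ 2.
Proof. by rewrite /nm re_quad im_quad. Qed.

Lemma quadM X Y X' Y' :
  quad X Y * quad X' Y' = quad (X * X' - n * Y * Y') (X * Y' + Y * X' + t * Y * Y').
Proof.
rewrite /quad.
have -> : (X%:~R + Y%:~R * tau) * (X'%:~R + Y'%:~R * tau) =
  X%:~R * X'%:~R + (X%:~R * Y'%:~R + Y%:~R * X'%:~R) * tau
  + Y%:~R * Y'%:~R * tau ^+ 2 by ring.
by rewrite tau_sq /quad; ring.
Qed.

Lemma nmM x y : nm (x * y) = nm x * nm y.
Proof.
by rewrite (quadE x) (quadE y) quadM !nm_quad; ring.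
Qed.

Lemma nm_int (m : int) : nm m%:~R = m ^+ 2.
Proof.
have -> : m%:~R = quad m 0 by rewrite /quad mul0r addr0.
by rewrite nm_quad; ring.
Qed.

Lemma nm1 : nm 1 = 1. Proof. by rewrite -[1 in LHS]/(1%:~R) nm_int. Qed.

Lemma nmN x : nm (- x) = nm x.
Proof. by rewrite -mulN1r nmM -[-1]/(-1)%:~R nm_int sqrrN expr1n mul1r. Qed.

(** Completing the square: the two terms are the squares of twice the real part and twice the
    imaginary part. *)
Lemma nm4E x : 4 * nm x = tr x ^+ 2 + (4 * n - t ^+ 2) * im x ^+ 2.
Proof. by rewrite /nm /tr; ring. Qed.

Lemma nm_ge0 x : 0 <= nm x.
Proof. have := nm4E x; nia. Qed.

Definition is_integer (x : R) := exists m : int, x = m%:~R.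

(** The bound on the discriminant enters here: 4 N(x) >= 4 n - t^2 > 12, and N(x) is an integer. *)
Lemma nm_nonint x : ~ is_integer x -> 4 <= nm x.
Proof.
move=> nx; have im0 : im x != 0.
  apply/eqP => im0; apply: nx; exists (re x).
  by rewrite {1}(quadE x) im0 /quad mul0r addr0.
have := nm4E x; have : 0 < im x ^+ 2 by rewrite exprn_even_gt0.
nia.
Qed.

Lemma nm_small x : [\/ x = 0, x = 1, x = -1 | 4 <= nm x].
Proof.
case: (pselect (is_integer x)) => [[m ->]|/nm_nonint]; last by constructor 4.
rewrite nm_int.
case: (ltgtP m 0) => m0; last by constructor 1; rewrite m0.
- case: (eqVneq m (-1)) => [->|]; first by constructor 3.
  by move=> ?; constructor 4; nia.
- case: (eqVneq m 1) => [->|]; first by constructor 2.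
  by move=> ?; constructor 4; nia.
Qed.

Lemma nm_eq0 x : nm x = 0 -> x = 0.
Proof.
move=> x0; case: (nm_small x) => //; last by rewrite x0.
  by move=> x1; move: x0; rewrite x1 nm1.
by move=> x1; move: x0; rewrite x1 nmN nm1.
Qed.

Lemma nm_ge1 x : x <> 0 -> 1 <= nm x.
Proof.
move=> x0; have := nm_ge0 x; rewrite le_eqVlt => /orP[/eqP/esym/nm_eq0 //|].
by rewrite gtz0_ge1.
Qed.

Lemma nm_unit x : nm x <= 1 -> x <> 0 -> x = 1 \/ x = -1.
Proof.
move=> x1 x0; case: (nm_small x) => [//||| x4]; [by left | by right |].
by have := le_trans x4 x1.
Qed.

Lemma mul_conjq x : x * conjq x = (nm x)%:~R.
Proof.
rewrite {1}(quadE x) quadM.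
have -> : (nm x)%:~R = quad (nm x) 0 by rewrite /quad mul0r addr0.
by rewrite /nm; congr quad; ring.
Qed.

Lemma nm_conjq x : nm (conjq x) = nm x.
Proof. by rewrite nm_quad /nm; ring. Qed.

Lemma nm_1sub (m : int) x : nm (1 - m%:~R * x) = 1 - m * tr x + m ^+ 2 * nm x.
Proof.
rewrite {1}(quadE x).
have -> : 1 - m%:~R * quad (re x) (im x) = quad (1 - m * re x) (- (m * im x)).
  by rewrite /quad; ring.
by rewrite nm_quad /nm /tr; ring.
Qed.

Lemma mulR_eq0 (x y : R) : x * y = 0 -> x = 0 \/ y = 0.
Proof.
move/(congr1 nm); rewrite nmM.
have -> : nm 0 = 0 by rewrite -[0 in LHS]/(0%:~R) nm_int.
by move/eqP; rewrite mulf_eq0 => /orP[]/eqP/nm_eq0; [left|right].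
Qed.

Section Norm.
Variable F : rcfType.

(** The complex absolute value, obtained from the norm form without choosing a complex embedding. *)
Definition nrm x : F := Num.sqrt (nm x)%:~R.

Lemma nrm_ge0 x : 0 <= nrm x. Proof. exact: sqrtr_ge0. Qed.

Lemma nrm_sq x : nrm x ^+ 2 = (nm x)%:~R.
Proof. by rewrite sqr_sqrtr// ler0z nm_ge0. Qed.

Lemma nrmM x y : nrm (x * y) = nrm x * nrm y.
Proof. by rewrite /nrm nmM intrM sqrtrM// ler0z nm_ge0. Qed.

Lemma nrmN x : nrm (- x) = nrm x. Proof. by rewrite /nrm nmN. Qed.

Lemma nrm_int (m : int) : nrm m%:~R = `|m%:~R|.
Proof. by rewrite /nrm nm_int rmorphXn /= sqrtr_sqr. Qed.

Lemma nrm_le x y : (nrm x <= nrm y) = (nm x <= nm y).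
Proof. by rewrite ler_sqrt ?ler_int// ler0z nm_ge0. Qed.

Lemma nrmD x y : nrm (x + y) <= nrm x + nrm y.
Proof.
rewrite -[leRHS]ger0_norm ?addr_ge0 ?nrm_ge0// -sqrtr_sqr ler_sqrt ?sqr_ge0//.
(* B is the trace of x times the conjugate of y. The identity [BE] is Cauchy-Schwarz with its defect
   made explicit. *)
set B : int := nm (x + y) - nm x - nm y.
have BE : B ^+ 2 = 4 * nm x * nm y
    - (4 * n - t ^+ 2) * (re x * im y - re y * im x) ^+ 2.
  have -> : B = 2 * re x * re y + t * (re x * im y + re y * im x) + 2 * n * im x * im y.
    rewrite /B {1}(quadE x) {1}(quadE y).
    have -> : quad (re x) (im x) + quad (re y) (im y) =
       quad (re x + re y) (im x + im y) by rewrite /quad; ring.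
    by rewrite nm_quad /nm; ring.
  by rewrite /nm; ring.
have B2 : B ^+ 2 <= 4 * nm x * nm y.
  by rewrite BE gerBl mulr_ge0 ?sqr_ge0//; lia.
have -> : nm (x + y) = nm x + nm y + B by rewrite /B; ring.
clearbody B; rewrite sqrrD !nrm_sq (intrD _ _ B) (intrD _ (nm x)) -nrmM mulr2n.
set c := nrm (x * y).
have c2 : (B%:~R : F) ^+ 2 <= 4 * c ^+ 2.
  by rewrite nrm_sq nmM -rmorphXn /= -[4]/(4%:~R) -intrM ler_int mulrA.
have := nrm_ge0 (x * y); rewrite -/c => c0.
suff BC : B%:~R <= 2 * c by lra.
have [B0|B0] := leP 0 (B%:~R : F); last by lra.
rewrite -(@ler_pXn2r _ 2)// ?nnegrE ?mulr_ge0//.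
by rewrite exprMn (le_trans c2)// -natrX.
Qed.

Lemma nrmB x y : nrm x - nrm y <= nrm (x - y).
Proof. by rewrite lerBlDr -{1}(subrK y x) nrmD. Qed.

Lemma nrm_nonint x : ~ is_integer x -> 2 <= nrm x.
Proof.
move/nm_nonint => x4; have -> : 2 = nrm 2%:~R by rewrite nrm_int ger0_norm.
by rewrite nrm_le nm_int.
Qed.

End Norm.
End QuadraticRing.

Lemma nearest_multiple (a c : int) : c != 0 -> exists m, `|a - m * c| < `|c|.
Proof.
move=> c0; exists (a %/ c)%Z.
rewrite {1}(divz_eq a c) addrC addKr ger0_norm ?modz_ge0//.
exact: ltz_mod.
Qed.

(** * Normal forms in the amalgam and the ping-pong bounds *)

Section PingPong.
Variables (R : comNzRingType) (tau : R) (t n : int).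
Hypothesis qR : quadratic_ring tau t n.
Variable F : rcfType.

Local Notation nrm := (nrm qR F).

(* The images of (1, 0) and (-1, 0) under the reduced words of the amalgam
   PSL2(Z) *_Z O: those whose leftmost letter is in PSL2(Z), outside the
   translations, for [true]; the others, the empty word included, for [false]. *)
Inductive reach : bool -> R -> R -> Prop :=
| reach_origin e : e = 1 \/ e = -1 -> reach false e 0
| reach_modular (a b c d : int) x y x' y' :
    a * d - b * c = 1 -> c != 0 -> x' = a%:~R * x + b%:~R * y ->
    y' = c%:~R * x + d%:~R * y -> reach false x y -> reach true x' y'
| reach_shift q x y x' : ~ is_integer q -> x' = x + q * y ->
    reach true x y -> reach false x' y.

Lemma reachN k x y : reach k x y -> reach k (- x) (- y).
Proof.
elim=> {k x y} [e e1|a b c d x y _ _ det c0 -> -> r _|q x y _ nq -> r IH].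
- by rewrite oppr0; apply: reach_origin; case: e1 => ->; rewrite ?opprK; auto.
- apply: (@reach_modular (- a) (- b) (- c) (- d)) r; rewrite ?oppr_eq0//.
  + by rewrite -det; ring.
  + by ring.
  + by ring.
- by apply: (reach_shift nq) IH; ring.
Qed.

(** The orbit of (1, 0) under E2, given by normal forms so that the ping-pong bounds apply to its
    elements. *)
Definition unit_orbit x y := reach true x y \/ reach false x y.

Lemma unit_orbitN x y : unit_orbit x y -> unit_orbit (- x) (- y).
Proof. by case=> /reachN; [left | right]. Qed.

(** The leftmost modular letter absorbs an integral translation, which leaves its lower row
    unchanged. *)
Lemma reach_translate (m : int) x y :
  reach true x y -> reach true (x + m%:~R * y) y.
Proof.
move E : true => k r; case: r E => // a b c d {}x {}y _ _ det c0 -> -> r _.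
apply: (@reach_modular (a + m * c) (b + m * d) c d) r => //.
- by rewrite -det; ring.
- by ring.
Qed.

Lemma is_integerD (x y : R) : is_integer x -> is_integer y -> is_integer (x + y).
Proof. by move=> [m ->] [k ->]; exists (m + k); rewrite intrD. Qed.

(** Consecutive shifts merge into one; if their sum is integral, the next modular letter absorbs
    it. *)
Lemma unit_orbit_shift q x y : unit_orbit x y -> unit_orbit (x + q * y) y.
Proof.
case=> r.
- case: (pselect (is_integer q)) => [[m ->]|nq].
    by left; apply: reach_translate.
  by right; apply: reach_shift nq _ r.
- move E : false r => k r; case: r E => // [e e1 _|b {}x {}y _ nb -> r _].
    by rewrite mulr0 addr0; right; apply: reach_origin.
  rewrite -addrA -mulrDl; case: (pselect (is_integer (b + q))) => [[m ->]|nq].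
    by left; apply: reach_translate.
  by right; apply: reach_shift nq _ r.
Qed.

Lemma unit_orbit_swap x y : unit_orbit x y -> unit_orbit (- y) x.
Proof.
case=> r; last first.
  left; apply: (@reach_modular 0 (-1) 1 0) r => //.
  - by ring.
  - by ring.
move E : true r => k r; case: r E => // a b c d {}x {}y _ _ det c0 -> -> r _.
case: (eqVneq a 0) => [a0|a0]; last first.
  left; apply: (@reach_modular (- c) (- d) a b) r => //.
  - by rewrite -det; ring.
  - by ring.
(* For a = 0 the swap times the modular letter is, up to sign, an integral translation: the letter
   cancels and only a shift of (x, y) remains. *)
have bc : b * c = -1 by move: det; rewrite a0; lia.
have -> : - (c%:~R * x + d%:~R * y) = - (c%:~R * x) + (d * c)%:~R * (b%:~R * y).
  have -> : - (c%:~R * x + d%:~R * y) = - (c%:~R * x) - d%:~R * y by ring.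
  have -> : (d * c)%:~R * (b%:~R * y) = (d * (b * c))%:~R * y by ring.
  by rewrite bc; ring.
rewrite a0 mul0r add0r.
have b1 : b = 1 \/ b = -1.
  have b2 : b < 2 by rewrite ltNge; apply/negP => ?; nia.
  have bm2 : -2 < b by rewrite ltNge; apply/negP => ?; nia.
  have b0 : b <> 0 by move=> b0; move: bc; rewrite b0 mul0r.
  by lia.
have cb : c = - b by case: b1 bc => ->; lia.
have sb : unit_orbit (b%:~R * x) (b%:~R * y).
  case: b1 => ->.
    by rewrite !mul1r; right.
  by rewrite !mulN1r; apply: unit_orbitN; right.
have -> : - (c%:~R * x) = b%:~R * x by rewrite cb; ring.
exact: unit_orbit_shift.
Qed.

Lemma nrm_intM (m : int) x : nrm (m%:~R * x) = (`|m|)%:~R * nrm x.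
Proof. by rewrite nrmM nrm_int intr_norm. Qed.

(* Ping-pong: x / y lies in a closed unit disk centred at an integer for [true],
   and outside the corresponding open disks for [false]. *)
Lemma reach_nrm k x y : reach k x y ->
  if k then exists m : int, nrm (x - m%:~R * y) <= nrm y
  else forall m : int, nrm y <= nrm (x - m%:~R * y).
Proof.
elim=> {k x y} [e _ m|a b c d x y x' y' det c0 Ex' Ey' _ far|q x y _ nq -> _ [m le] k].
- by rewrite mulr0 subr0 -[0 in leLHS]/(0%:~R) nrm_int normr0 nrm_ge0.
(* The remainder r of -d modulo c has |r| + 1 <= |c|, so |y'| >= |c| |x - e y| - |r| |y| >= |y|. *)
- have lower : nrm y <= nrm y'.
    have [e /= fc] := nearest_multiple (- d) c0.
    have -> : y' = c%:~R * (x - e%:~R * y) - (- d - e * c)%:~R * y by rewrite Ey'; ring.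
    apply: le_trans (nrmB _ _ _ _); rewrite !nrm_intM.
    have := far e; have := nrm_ge0 qR F y.
    have : ((`|- d - e * c|)%:~R + 1 : F) <= (`|c|)%:~R.
      by rewrite -[1]/(1%:~R) -intrD ler_int; lia.
    have : 0 <= ((`|- d - e * c|)%:~R : F) by rewrite ler0z.
    move: (nrm y) (nrm _) (_%:~R) (_%:~R) => *; nra.
  (* As the determinant is 1, c (x' - m y') = (a - m c) y' - y; with |y| <= |y'| its absolute value
     is at most (|a - m c| + 1) |y'| <= |c| |y'|. *)
  have [m rc] := nearest_multiple a c0; exists m.
  have : (`|c|)%:~R * nrm (x' - m%:~R * y') <=
         (`|a - m * c|)%:~R * nrm y' + nrm y.
    rewrite -!nrm_intM -(nrmN _ _ y).
    have -> : c%:~R * (x' - m%:~R * y') = (a - m * c)%:~R * y' + - y.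
      transitivity ((a - m * c)%:~R * y' - (a * d - b * c)%:~R * y).
        by rewrite Ex' Ey'; ring.
      by rewrite det mul1r.
    exact: nrmD.
  have : ((`|a - m * c|)%:~R + 1 : F) <= (`|c|)%:~R.
    by rewrite -[1]/(1%:~R) -intrD ler_int; lia.
  have : 0 <= ((`|a - m * c|)%:~R : F) by rewrite ler0z.
  move: lower (nrm_ge0 qR F y) (nrm_ge0 qR F (x' - m%:~R * y')).
  move: (nrm y) (nrm y') (nrm (x' - m%:~R * y')) (`|a - m * c|%:~R) (`|c|%:~R).
  move=> u v w s r uv u0 w0 s0 sr le; rewrite leNgt; apply/negP => vw.
  have : 0 < r * (w - v) by apply: mulr_gt0; lra.
  have : 0 <= (r - 1 - s) * v by apply: mulr_ge0; lra.
  by lra.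
(* The centre q + m is at distance at least 2 from the integer k, since q + m - k is not an
   integer. *)
- have -> : x + q * y - k%:~R * y = (q + m%:~R - k%:~R) * y - - (x - m%:~R * y) by ring.
  apply: le_trans (nrmB _ _ _ _); rewrite nrmN nrmM.
  have : 2 <= nrm (q + m%:~R - k%:~R).
    apply: nrm_nonint => iq; apply: nq.
    have -> : q = q + m%:~R - k%:~R + (k - m)%:~R by ring.
    by apply: is_integerD => //; exists (k - m).
  have := nrm_ge0 qR F y; nra.
Qed.

Lemma unit_orbit_close x y : unit_orbit x y ->
  y = 0 \/ exists q, nrm (x - q * y) <= nrm y.
Proof.
case=> [/reach_nrm[m le]|r]; first by right; exists m%:~R.
move E : false r => k r; case: r E => // [e e1 _|q {}x {}y _ nq -> r _]; first by left.
have [m le] := reach_nrm r; right; exists (q + m%:~R).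
by have -> : x + q * y - (q + m%:~R) * y = x - m%:~R * y by ring.
Qed.

End PingPong.

(** * Explicit two-by-two matrices and elements of PE2 *)

Section TwoByTwo.
Variable R : comNzRingType.

Definition mx2 (a b c d : R) : 'M[R]_2 :=
  \matrix_(i, j) if i == 0 then (if j == 0 then a else b) else if j == 0 then c else d.

Lemma mx2E (A : 'M[R]_2) : A = mx2 (A 0 0) (A 0 1) (A 1 0) (A 1 1).
Proof.
apply/matrixP => i j; rewrite mxE.
have E (k : 'I_2) : k = 0 \/ k = 1.
  by case: k => [[|[|//]] ?]; [left | right]; apply: val_inj.
by case: (E i) => ->; case: (E j) => ->.
Qed.

Lemma mulmx2 a b c d a' b' c' d' : mx2 a b c d *m mx2 a' b' c' d' =
  mx2 (a * a' + b * c') (a * b' + b * d') (c * a' + d * c') (c * b' + d * d').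
Proof.
by rewrite [LHS]mx2E !mxE !big_ord_recl !big_ord0 !mxE /= !addr0.
Qed.

Lemma mx2_scalar (a : R) : a%:M = mx2 a 0 0 a.
Proof. by rewrite [LHS]mx2E !mxE. Qed.

Lemma oppmx2 a b c d : - mx2 a b c d = mx2 (- a) (- b) (- c) (- d).
Proof. by rewrite [LHS]mx2E !mxE. Qed.

Lemma det_mx2 a b c d : \det (mx2 a b c d) = a * d - b * c.
Proof.
rewrite (expand_det_row _ 0) !big_ord_recl big_ord0 /cofactor !det_mx11 !mxE /=.
by ring.
Qed.

Fact mkSL2_subproof a b c d : a * d - b * c = 1 -> \det (mx2 a b c d) == 1.
Proof. by rewrite det_mx2 => ->. Qed.

Definition mkSL2 a b c d (det : a * d - b * c = 1) : SL2 R :=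
  Sub (mx2 a b c d) (mkSL2_subproof det).

Lemma SL2E (A : SL2 R) : exists a b c d (det : a * d - b * c = 1), A = mkSL2 det.
Proof.
have := SL2_det A; rewrite [val A]mx2E det_mx2 => det.
exists (val A 0 0), (val A 0 1), (val A 1 0), (val A 1 1), det.
by apply: val_inj; rewrite /= -mx2E.
Qed.

Fact inv_det a b c d : a * d - b * c = 1 :> R -> d * a - - b * - c = 1.
Proof. by move=> <-; ring. Qed.

Lemma mkSL2V a b c d (det : a * d - b * c = 1) :
  ((mkSL2 det)^-1)%g = mkSL2 (inv_det det).
Proof.
apply: mulg1_eq; apply: val_inj; rewrite /= mulmx2 mx2_scalar -det.
by congr mx2; ring.
Qed.

Fact translation_det (q : R) : 1 * 1 - q * 0 = 1. Proof. by ring. Qed.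
Definition translation q : SL2 R := mkSL2 (translation_det q).

Lemma translationD p q : translation (p + q) = (translation p * translation q)%g.
Proof. by apply: val_inj; rewrite /= mulmx2; congr mx2; ring. Qed.

Lemma translation0 : translation 0 = 1%g.
Proof. by apply: val_inj; rewrite /= mx2_scalar. Qed.

Lemma translationN q : translation (- q) = (translation q)^-1%g.
Proof. by rewrite /translation mkSL2V; apply: val_inj; rewrite /=; congr mx2; ring. Qed.

Lemma swap_mxE : swap_mx R = mx2 0 (-1) 1 0.
Proof. by rewrite [LHS]mx2E !mxE. Qed.

Lemma class_ofM (A B : SL2 R) : class_of (A * B)%g = (class_of A * class_of B)%g.
Proof. by rewrite -PSL2_mulE. Qed.

Lemma class_ofV (A : SL2 R) : class_of (A^-1)%g = ((class_of A)^-1)%g.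
Proof. by rewrite -PSL2_invE. Qed.

Lemma PE2_subgroup : is_subgroup (@PE2 R). Proof. exact: generated_subgroup. Qed.

Lemma PE2M x y : PE2 x -> PE2 y -> PE2 (x * y : PSL2 R)%g.
Proof. by case: PE2_subgroup => _ + _; apply. Qed.

Lemma PE2V x : PE2 x -> PE2 (x^-1 : PSL2 R)%g.
Proof. by case: PE2_subgroup => _ _; apply. Qed.

Lemma PE2_elementary (A : SL2 R) : elementary_mx (val A) -> PE2 (class_of A).
Proof. by move=> eA M [_]; apply; exists A. Qed.

Lemma PE2_lower_left0 a b d (det : a * d - b * 0 = 1) : PE2 (class_of (mkSL2 det)).
Proof.
apply: PE2_elementary; apply/or4P; constructor 3; apply/is_trig_mxP => i j.
by rewrite !mxE; case: i j => [[|[|//]] ?] [[|[|//]] ?].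
Qed.

End TwoByTwo.

(** * Invariance of the orbit under PE2 *)

Section OrbitStability.
Variables (R : comNzRingType) (tau : R) (t n : int).
Hypothesis qR : quadratic_ring tau t n.

Local Notation nm := (nm qR).
Local Notation tr := (tr qR).
Local Notation conjq := (conjq qR).

(** An equivalence, so that stability passes to inverses. *)
Definition orbit_stable (A : 'M[R]_2) := forall x y : R,
  unit_orbit (A 0 0 * x + A 0 1 * y) (A 1 0 * x + A 1 1 * y) <-> unit_orbit x y.

Lemma orbit_stable_mx2 a b c d : orbit_stable (mx2 a b c d) <->
  forall x y, unit_orbit (a * x + b * y) (c * x + d * y) <-> unit_orbit x y.
Proof. by rewrite /orbit_stable !mxE /=. Qed.

Lemma orbit_stableM A B :
  orbit_stable A -> orbit_stable B -> orbit_stable (A *m B).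
Proof.
rewrite (mx2E A) (mx2E B) mulmx2 !orbit_stable_mx2 => sA sB x y.
apply: iff_trans (sB x y); apply: iff_trans (sA _ _).
have E a b c d e f : (a * c + b * e) * x + (a * d + b * f) * y =
  a * (c * x + d * y) + b * (e * x + f * y) :> R by ring.
by rewrite !E.
Qed.

Lemma unit_orbitNE (x y : R) : unit_orbit (- x) (- y) <-> unit_orbit x y.
Proof. by split=> /unit_orbitN; rewrite ?opprK. Qed.

Lemma orbit_stableN A : orbit_stable A -> orbit_stable (- A).
Proof.
rewrite (mx2E A) oppmx2 !orbit_stable_mx2 => sA x y.
apply: iff_trans (sA x y); apply: iff_trans (iff_sym (unit_orbitNE _ _)) _.
by rewrite !opprD !mulNr !opprK.
Qed.

Lemma orbit_stable_sign (A B : SL2 R) :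
  class_of A = class_of B -> orbit_stable (val A) -> orbit_stable (val B).
Proof.
move/class_ofP=> E sA; case: E => E; first by rewrite -E.
by rewrite -[val B]opprK -E; apply: orbit_stableN.
Qed.

Lemma orbit_stableV (A : SL2 R) :
  orbit_stable (val A) -> orbit_stable (val (A^-1)%g).
Proof.
have [a [b [c [d [det ->]]]]] := SL2E A.
rewrite mkSL2V /= !orbit_stable_mx2 => sA x y.
apply: iff_sym; apply: iff_trans (sA (d * x + - b * y) (- c * x + a * y)).
have -> : a * (d * x + - b * y) + b * (- c * x + a * y) = x.
  by rewrite -[RHS]mul1r -det; ring.
have -> : c * (d * x + - b * y) + d * (- c * x + a * y) = y.
  by rewrite -[RHS]mul1r -det; ring.
by [].
Qed.

Lemma orbit_stable_shift q : orbit_stable (mx2 1 q 0 1).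
Proof.
apply/orbit_stable_mx2 => x y; rewrite !mul1r mul0r add0r.
split=> [/(unit_orbit_shift (- q))|]; last exact: unit_orbit_shift.
by rewrite mulNr addrK.
Qed.

Lemma orbit_stable_swap : orbit_stable (swap_mx R).
Proof.
rewrite swap_mxE; apply/orbit_stable_mx2 => x y.
rewrite !mul0r add0r mul1r addr0 mulN1r.
split=> [|/unit_orbit_swap //]; move/unit_orbit_swap/unit_orbitN.
by rewrite !opprK.
Qed.

Lemma SL2_unit (a d : R) : a * d = 1 -> (a = 1 /\ d = 1) \/ (a = -1 /\ d = -1).
Proof.
move=> ad; have := congr1 nm ad; rewrite nmM nm1 => nad.
have d0 : d <> 0.
  by move=> d0; move: ad; rewrite d0 mulr0 => /eqP; rewrite eq_sym oner_eq0.
have a1 : nm a <= 1.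
  have := nm_ge0 qR a; have := nm_ge1 qR d0; move: nad.
  by move: (nm a) (nm d) => u v *; nia.
have a0 : a <> 0.
  by move=> a0; move: ad; rewrite a0 mul0r => /eqP; rewrite eq_sym oner_eq0.
case: (nm_unit a1 a0) ad => ->; rewrite ?mul1r ?mulN1r => ad; [left | right] => //.
by rewrite -ad opprK.
Qed.

(** The only units being +-1, such a matrix is a translation up to sign. *)
Lemma orbit_stable_upper (A : SL2 R) : val A 1 0 = 0 -> orbit_stable (val A).
Proof.
have [a [b [c [d [det ->]]]]] := SL2E A; rewrite /= mxE /= => c0.
move: det; rewrite c0 mulr0 subr0 => /SL2_unit[] [-> ->].
  exact: orbit_stable_shift.
have -> : mx2 (-1) b 0 (-1) = - mx2 1 (- b) 0 1 by rewrite oppmx2 opprK oppr0.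
exact/orbit_stableN/orbit_stable_shift.
Qed.

Lemma orbit_stable_elementary (A : SL2 R) :
  elementary_mx (val A) -> orbit_stable (val A).
Proof.
have upper : is_trig_mx (val A)^T -> orbit_stable (val A).
  by move=> /is_trig_mxP/(_ 0 1 isT); rewrite mxE; apply: orbit_stable_upper.
case/or4P => [/is_diag_mxP d|/is_trig_mxP/(_ 0 1 isT) A01|//|/eqP->]; last first.
- exact: orbit_stable_swap.
(* Conjugation by the swap makes a lower triangular matrix upper triangular. *)
- have det1 : 0 * 0 - (-1) * 1 = 1 :> R by ring.
  pose S := mkSL2 det1.
  have sS : orbit_stable (val S) by rewrite /= -swap_mxE; apply: orbit_stable_swap.
  have -> : A = (S^-1 * (S * A * S^-1) * S)%g by rewrite !mulgA mulVg mul1g mulgVK.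
  apply: (orbit_stableM _ sS); apply: orbit_stableM (orbit_stableV sS) _.
  apply: orbit_stable_upper; move: A01.
  have [a [b [c [d [det ->]]]]] := SL2E A; rewrite mkSL2V /= mxE /= => ->.
  by rewrite !mulmx2 mxE /=; ring.
- by apply: orbit_stable_upper; apply: d.
Qed.

Lemma PE2_orbit_stable (A : SL2 R) : PE2 (class_of A) -> orbit_stable (val A).
Proof.
(* Quantifying over all lifts gives a set of classes; it is a subgroup containing the generators. *)
pose M := [set x | forall B : SL2 R, class_of B = x -> orbit_stable (val B)]%classic.
suff : (@PE2 R `<=` M)%classic by move=> PM /PM; apply.
apply: smallest_sub; last first.
  move=> _ [B eB <-] C CB.
  by apply: orbit_stable_sign (esym CB) _; apply: orbit_stable_elementary.
split.
- move=> B B1; apply: orbit_stable_sign (esym B1) _.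
  by rewrite -translation0; apply: orbit_stable_shift.
- move=> x y Mx My B Bxy.
  apply: orbit_stable_sign (_ : class_of (repr x * repr y)%g = _) _.
    by rewrite Bxy class_ofM !repr_class.
  by apply: orbit_stableM; [apply: Mx | apply: My]; rewrite repr_class.
- move=> x Mx B Bx; apply: orbit_stable_sign (_ : class_of (repr x)^-1%g = _) _.
    by rewrite Bx class_ofV repr_class.
  by apply: orbit_stableV; apply: Mx; rewrite repr_class.
Qed.

(** The first column (a, c) is the image of (1, 0), so it lies in the orbit. *)
Lemma PE2_close a b c d (det : a * d - b * c = 1) : PE2 (class_of (mkSL2 det)) ->
  c = 0 \/ exists q, nm (a - q * c) <= nm c.
Proof.
move=> /PE2_orbit_stable/=/orbit_stable_mx2/(_ 1 0).
rewrite !mulr1 !mulr0 !addr0 => -[_ /(_ _)].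
move=> H; have /H : @unit_orbit R 1 0 by right; apply: reach_origin; left.
(* Any real closed field would do, the conclusion being an inequality between integers. *)
move/(unit_orbit_close qR realalg) => [->|[q le]]; [by left | right; exists q].
by rewrite nrm_le in le.
Qed.

End OrbitStability.

(* With C = N(c), P = N(a - q c) and T = tr (c (a - q c)), this compares
   N(c^2 y) with N(1 - y c (a - q c)), that is, the distance from
   a/c - 1/(c^2 y) to q with 1. *)
Lemma disk_gap (y T C P : int) : 1 <= C -> C <= P -> T ^+ 2 <= 4 * (C * P) ->
  3 <= `|y| -> (P = C -> y * T <= 0) ->
  y ^+ 2 * C ^+ 2 < 1 - y * T + y ^+ 2 * (C * P).
Proof.
move=> C1 CP T2 y3 tie; have y9 : 9 <= y ^+ 2.
  by have : 3 ^+ 2 <= `|y| ^+ 2; [rewrite lerXn2r | rewrite real_normK ?num_real].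
have [PC|PC] := eqVneq P C.
  by have := tie PC; rewrite PC -expr2; move: (y * T) (_ * _) => *; lia.
have D1 : 1 <= P - C by lia.
rewrite -subr_gt0.
have -> : 1 - y * T + y ^+ 2 * (C * P) - y ^+ 2 * C ^+ 2 =
  y ^+ 2 * (C * (P - C)) + 1 - y * T by ring.
set D := P - C in D1 *; have PE : P = C + D by rewrite /D; ring.
rewrite PE in T2; clearbody D.
(* Otherwise y T > y^2 C D, and squaring gives 9 (C D)^2 <= y^2 (C D)^2 < T^2 <= 4 C (C + D) <= 8 (C
   D)^2. *)
rewrite subr_gt0 ltNge; apply/negP => le.
have CD1 : 1 <= C * D by rewrite -[1]mulr1 ler_pM.
have sq : (y ^+ 2 * (C * D)) ^+ 2 < (y * T) ^+ 2.
  have z0 : 0 <= y ^+ 2 * (C * D) by rewrite mulr_ge0 ?sqr_ge0//; lia.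
  by rewrite ltr_pXn2r ?nnegrE//; move: (y * T) (_ * _) le z0 => *; lia.
have : y ^+ 2 * (C * D) ^+ 2 < T ^+ 2.
  have : y ^+ 2 * (y ^+ 2 * (C * D) ^+ 2) < y ^+ 2 * T ^+ 2.
    rewrite -[ltRHS]exprMn; apply: le_lt_trans sq.
    by rewrite le_eqVlt; apply/orP; left; apply/eqP; ring.
  by rewrite ltr_pM2l//; lia.
have : 9 * (C * D) ^+ 2 <= y ^+ 2 * (C * D) ^+ 2 by rewrite ler_wpM2r ?sqr_ge0.
have : C * (C + D) <= 2 * (C * D) ^+ 2.
  have -> : 2 * (C * D) ^+ 2 = C * (2 * (C * D) * D) by ring.
  apply: ler_wpM2l; first by lia.
  have : C <= C * D by rewrite ler_peMr//; lia.
  have : D <= C * D by rewrite ler_peMl//; lia.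
  have : 2 * (C * D) <= 2 * (C * D) * D by rewrite ler_peMr//; lia.
  by move: (C * D) => E; lia.
have : 1 <= (C * D) ^+ 2 by rewrite exprn_ege1.
by move: T2; move: ((C * D) ^+ 2) (C * (C + D)) (y ^+ 2 * _) (T ^+ 2) => *; lia.
Qed.

(** * Conjugates of translations, and descent on the lower left entry *)

Section SelfNormalizing.
Variables (R : comNzRingType) (tau : R) (t n : int).
Hypothesis qR : quadratic_ring tau t n.

Local Notation nm := (nm qR).
Local Notation tr := (tr qR).
Local Notation conjq := (conjq qR).

Lemma nm0 : nm 0 = 0.
Proof. by rewrite -[0 in LHS]/(0%:~R) nm_int. Qed.

(** Multiplying the determinant relation by conj(c), and using N(p) = N(c), shows that p divides
    conj(c); equal norms make the quotient a unit, hence +-1. *)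
Lemma unimodular_conjq p d b c : p * d - b * c = 1 -> c <> 0 ->
  nm p = nm c -> p = conjq c \/ p = - conjq c.
Proof.
move=> det c0 npc; pose s := conjq c * d - conjq p * b.
have ps : p * s = conjq c.
  have -> : p * s = p * d * conjq c - p * conjq p * b by rewrite /s; ring.
  by rewrite mul_conjq npc -(mul_conjq qR c) -[RHS]mul1r -det; ring.
have c1 := nm_ge1 qR c0.
have ns : nm s = 1.
  have := congr1 nm ps; rewrite nmM nm_conjq npc -[RHS]mulr1.
  by apply: mulfI; lia.
have s0 : s <> 0 by move=> s0; move: ns; rewrite s0 nm0.
have /nm_unit/(_ s0)[s1|s1] : nm s <= 1 by rewrite ns.
  by left; rewrite -ps s1 mulr1.
by right; rewrite -ps s1 mulrN1 opprK.
Qed.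

(* Two distinct centres would give c w = 2 with w = +-1, and then 4 N(d) would be
   odd. *)
Lemma equidistant_unique a b c d q q' : a * d - b * c = 1 -> c <> 0 ->
  (forall q, nm c <= nm (a - q * c)) ->
  nm (a - q * c) = nm c -> nm (a - q' * c) = nm c -> q = q'.
Proof.
move=> det c0 far nq nq'.
have detq k : (a - k * c) * d - (b - k * d) * c = 1 by rewrite -det; ring.
have same : a - q * c = a - q' * c -> q = q'.
  move=> E; have : (q - q') * c = 0.
    have -> : (q - q') * c = (a - q' * c) - (a - q * c) by ring.
    by rewrite E subrr.
  by case/(mulR_eq0 qR) => [/eqP|//]; rewrite subr_eq0 => /eqP.
have oppo k k' e : e = 1 \/ e = -1 -> a - k * c = e * conjq c ->
    a - k' * c = - (e * conjq c) -> False.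
  move=> e1 E E'.
  have ne : nm e = 1 by case: e1 => ->; rewrite ?nmN nm1.
  have dc : (k' - k) * c = 2 * (e * conjq c).
    have -> : (k' - k) * c = (a - k * c) - (a - k' * c) by ring.
    by rewrite E E' opprK mulr_natl mulr2n.
  set w := (k' - k) * d - 2 * (b - k * d).
  have cw : c * w = 2.
    have -> : c * w = (k' - k) * c * d - 2 * ((b - k * d) * c) by rewrite /w; ring.
    by rewrite dc -mulrA -mulrBr -E detq mulr1.
  have n2 : nm 2 = 4 by rewrite -[2]/(2%:~R) nm_int.
  have ncw : nm c * nm w = 4 by rewrite -nmM cw.
  (* A unit c would divide a, against [far]. Hence N(c) >= 4, and N(c) N(w) = 4 leaves N(w) = 1. *)
  have cu u : u = 1 \/ u = -1 -> c = u -> False.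
    move=> u1 cu; have := far (a * u); rewrite cu.
    have -> : a - a * u * u = 0 by case: u1 => ->; ring.
    by rewrite nm0; case: u1 => ->; rewrite ?nmN nm1.
  have c4 : 4 <= nm c.
    case: (nm_small qR c) => // c1; exfalso.
      by apply: (cu 1) => //; left.
    by apply: (cu (-1)) => //; right.
  have w1 : nm w <= 1 by move: (nm c) (nm w) c4 ncw => u v *; nia.
  have w0 : w <> 0 by move=> w0; move: ncw; rewrite w0 nm0 mulr0.
  have nd : nm (k' - k) = 4.
    have := congr1 nm dc; rewrite !nmM nm_conjq ne n2 mul1r.
    by apply: mulIf; lia.
  have odd (m : int) (y z : R) : y = m%:~R * (1 - (- 2 * m)%:~R * z) -> m = 1 \/ m = -1 ->
     nm y = 1 + 2 * m * tr z + 4 * nm z.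
    by move=> -> m1; rewrite nmM nm_int nm_1sub; case: m1 => ->; ring.
  have wE : (k' - k) * d = w + 2 * (b - k * d) by rewrite /w; ring.
  have nkd : nm ((k' - k) * d) = 4 * nm d by rewrite nmM nd.
  have [e' [e'1 we]] : exists m : int, (m = 1 \/ m = -1) /\ w = m%:~R.
    by case: (nm_unit w1 w0) => ->; [exists 1 | exists (-1)]; auto.
  have := odd e' ((k' - k) * d) (b - k * d) _ e'1; rewrite nkd => H.
  have : 4 * nm d = 1 + 2 * e' * tr (b - k * d) + 4 * nm (b - k * d).
    by apply: H; rewrite wE we; case: e'1 => ->; ring.
  by case: e'1 => ->; move: (nm d) (tr _) (nm _) => *; lia.
have [Eq|Eq] := unimodular_conjq (detq q) c0 nq;
have [Eq'|Eq'] := unimodular_conjq (detq q') c0 nq'.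
- by apply: same; rewrite Eq Eq'.
- by case: (oppo q q' 1); rewrite ?mul1r; auto.
- by case: (oppo q' q 1); rewrite ?mul1r; auto.
- by apply: same; rewrite Eq Eq'.
Qed.

Lemma conj_translation (a b c d : R) (det : a * d - b * c = 1) x :
  exists det' : (1 - a * c * x) * (1 + a * c * x) - a ^+ 2 * x * - (c ^+ 2 * x) = 1,
  (mkSL2 det * translation x * (mkSL2 det)^-1)%g = mkSL2 det'.
Proof.
have det' : (1 - a * c * x) * (1 + a * c * x) - a ^+ 2 * x * - (c ^+ 2 * x) = 1 by ring.
exists det'; apply: val_inj; rewrite mkSL2V /= !mulmx2.
rewrite !(mulr1, mulr0, addr0); congr mx2; rewrite -?det; ring.
Qed.

Lemma far_not_PE2_conj a b c d (det : a * d - b * c = 1) (x : int) :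
  c <> 0 -> (forall q, nm c <= nm (a - q * c)) -> 3 <= `|x| ->
  ~ PE2 (class_of (mkSL2 det * translation x%:~R * (mkSL2 det)^-1)%g).
Proof.
move=> c0 far x3 Px.
have c1 := nm_ge1 qR c0.
pose p q := a - q * c.
(* The point a/c lies on at most one unit circle centred in the ring, so a single choice of sign y =
   +-x meets the tie condition of [disk_gap]. Changing the sign inverts the conjugate, which stays
   in PE2. *)
have [y [y3 Py tie]] : exists y : int, [/\ 3 <= `|y|,
    PE2 (class_of (mkSL2 det * translation y%:~R * (mkSL2 det)^-1)%g)
  & forall q, nm (p q) = nm c -> y * tr (c * p q) <= 0].
  have PN : PE2 (class_of (mkSL2 det * translation (- x)%:~R * (mkSL2 det)^-1)%g).
    rewrite rmorphN translationN; move/PE2V: Px.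
    by rewrite -class_ofV !invgM invgK !mulgA.
  case: (pselect (exists q, nm (p q) = nm c)) => [[q0 tq0]|nt]; last first.
    by exists x; split=> // q tq; case: nt; exists q.
  have uq q : nm (p q) = nm c -> q = q0.
    by move=> tq; apply: (equidistant_unique det c0 far tq tq0).
  case: (lerP (x * tr (c * p q0)) 0) => le.
    by exists x; split=> // q /uq->.
  exists (- x); split=> //; first by rewrite normrN.
  by move=> q /uq->; rewrite mulNr oppr_le0 ltW.
have [det' E] := conj_translation det y%:~R; move: Py; rewrite E => /(PE2_close qR).
have nc2 : nm (- (c ^+ 2 * y%:~R)) = y ^+ 2 * nm c ^+ 2.
  by rewrite nmN nmM nm_int expr2 nmM; ring.
case=> [z|[q]].
  move: nc2; rewrite z nm0 => /esym/eqP; rewrite mulf_eq0 !expf_eq0 /=.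
  by case/orP => /eqP ?; lia.
have -> : 1 - a * c * y%:~R - q * - (c ^+ 2 * y%:~R) = 1 - y%:~R * (c * p q).
  by rewrite /p; ring.
rewrite nc2 nm_1sub leNgt => /negP; apply.
have nE := nm4E qR (c * p q); rewrite nmM in nE *.
have fq := far q; rewrite -/(p q) in fq.
have T2 : tr (c * p q) ^+ 2 <= 4 * (nm c * nm (p q)).
  rewrite nE lerDl mulr_ge0 ?sqr_ge0//.
  by have [_ _ _] := qR; lia.
exact: (disk_gap c1 fq T2 y3 (tie q)).
Qed.

Lemma PE2_of_conj_translation (x : int) (h : SL2 R) : 3 <= `|x| ->
  PE2 (class_of (h * translation x%:~R * h^-1)%g) -> PE2 (class_of h).
Proof.
move=> x3; have [k] := ubnP `|(nm (val h 1 0))%R|%N.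
elim: k h => // k IH h; have [a [b [c [d [det ->]]]]] := SL2E h.
rewrite /= mxE /= ltnS => nk Px.
have [c0|c0] := eqVneq c 0.
  by subst c; apply: PE2_lower_left0.
move/eqP in c0.
case: (pselect (forall q, nm c <= nm (a - q * c))) => [far|].
  by case: (far_not_PE2_conj c0 far x3 Px).
move/existsNP => [q /negP]; rewrite -ltNge => lt.
have detS : 0 * 0 - (-1) * 1 = 1 :> R by ring.
(* A step of the Euclidean algorithm: the lower left entry of e h is a - q c, of norm less than
   N(c). *)
pose e := (mkSL2 detS * translation (- q))%g.
have Pe : PE2 (class_of e).
  rewrite class_ofM; apply: PE2M; last exact: PE2_lower_left0.
  apply: PE2_elementary; apply/or4P; constructor 4.
  by rewrite /= swap_mxE.
suff : PE2 (class_of (e * mkSL2 det)%g).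
  by rewrite class_ofM => /(PE2M (PE2V Pe)); rewrite mulKg.
apply: IH.
  apply: leq_trans nk; rewrite /= !mulmx2 mxE /=.
  have -> : (1 * 1 + 0 * 0) * a + (1 * - q + 0 * 1) * c = a - q * c by ring.
  by have := nm_ge0 qR (a - q * c); lia.
have -> : (e * mkSL2 det * translation x%:~R * (e * mkSL2 det)^-1 =
  e * (mkSL2 det * translation x%:~R * (mkSL2 det)^-1) * e^-1)%g.
  by rewrite invgM !mulgA.
rewrite (class_ofM _ e^-1%g) class_ofV; apply: PE2M (PE2V Pe).
by rewrite (class_ofM e); apply: PE2M Pe Px.
Qed.

End SelfNormalizing.

(** * Cosets and normalizers in an abstract group *)

Section GroupLemmas.
Variable G : groupType.
Implicit Types (H : set G) (g : G).

(** If g^i H = g^j H with i < j, then g^(j - i) is in H; so the cosets of the powers of g are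
    distinct. *)
Lemma infinite_index_expg H g : is_subgroup H ->
  (forall k, (0 < k)%N -> ~ H (g ^+ k)%g) -> infinite_index H.
Proof.
move=> [H1 HM HV] notH fin.
pose f i : set G := [set (g ^+ i * h)%g | h in H]%classic.
have f_inj : injective f.
  have lt_neq i j : (i < j)%N -> f i <> f j.
    move=> ij E; have : f j (g ^+ i)%g by rewrite -E; exists 1%g; rewrite ?mulg1.
    case=> h Hh E'; apply: (notH (j - i)%N); first by rewrite subn_gt0.
    have -> : (g ^+ (j - i) = h^-1)%g.
      apply/eqP; rewrite -mulg_eq1; apply/eqP.
      by apply: (mulgI (g ^+ i)%g); rewrite mulg1 -[RHS]E' mulgA -expgnDr subnKC// ltnW.
    exact: HV.
  move=> i j E; case: (ltngtP i j) => // /lt_neq; rewrite E //.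
apply: infinite_nat.
rewrite -(eq_finite_set (inj_card_eq (in2W f_inj))).
by apply: sub_finite_set fin => _ [i _ <-]; exists (g ^+ i)%g.
Qed.

Lemma sub_normalizer H : is_subgroup H -> (H `<=` normalizer H)%classic.
Proof.
move=> [H1 HM HV] g Hg; apply/seteqP; split=> [_ [h Hh <-]|h Hh].
  by apply: (HM); [apply: HM | apply: HV].
exists (g^-1 * h * g)%g; first by apply: (HM) => //; apply: HM => //; apply: HV.
by rewrite !mulgA mulgV mul1g mulgK.
Qed.

End GroupLemmas.

(** * Matrices outside PE2, infinite index and the normalizer *)

Section ProperSubgroup.
Variables (R : comNzRingType) (tau : R) (t n : int).
Hypothesis qR : quadratic_ring tau t n.

Local Notation nm := (nm qR).
Local Notation qtau := (quad tau).

Lemma far_not_PE2 a b c d (det : a * d - b * c = 1) : c <> 0 ->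
  (forall q, nm c < nm (a - q * c)) -> ~ PE2 (class_of (mkSL2 det)).
Proof.
move=> c0 far /(PE2_close qR)[//|[q]].
by rewrite leNgt far.
Qed.

Lemma quad4E (X Y : int) :
  4 * nm (qtau X Y) = (2 * X + t * Y) ^+ 2 + (4 * n - t ^+ 2) * Y ^+ 2.
Proof. by rewrite nm_quad; ring. Qed.

(* a/c = (1 + 2 tau)/4 is close to the middle of the segment from 0 to tau. *)
Lemma not_PE2_large_disc : 16 <= 4 * n - t ^+ 2 ->
  exists A : SL2 R, ~ PE2 (class_of A).
Proof.
(* N(1 + 2 tau) = 1 + 2 s, and (1 + 2 s)(1 - 2 s) + 4 s^2 = 1 completes the column (1 + 2 tau, 4) to
   determinant 1. *)
move=> D16; pose s := t + 2 * n.
have det : qtau 1 2 * (qtau (1 + 2 * t) (-2) * (1 - 2 * s)%:~R)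
    - (- s ^+ 2)%:~R * 4%:~R = 1 :> R.
  rewrite mulrA (quadM qR).
  have -> : qtau (1 * (1 + 2 * t) - n * 2 * -2) (1 * -2 + 2 * (1 + 2 * t) + t * 2 * -2)
     = (1 + 2 * s)%:~R by rewrite /quad /s; ring.
  by ring.
exists (mkSL2 det); apply: far_not_PE2.
  by move/(congr1 nm); rewrite nm_int nm0.
move=> q; rewrite nm_int.
have -> : qtau 1 2 - q * 4%:~R = qtau (1 - 4 * re qR q) (2 - 4 * im qR q).
  by rewrite {1}(quadE qR q) /quad; ring.
set X := re qR q; set Y := im qR q.
have := quad4E (1 - 4 * X) (2 - 4 * Y).
set N := nm _; set U := 2 * _ + _; set D := _ - _ in D16 * => E.
have Y4 : 4 <= (2 - 4 * Y) ^+ 2 by nia.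
suff : 64 < U ^+ 2 + D * (2 - 4 * Y) ^+ 2 by lia.
have [D17|] := leP 17 D; first by have := sqr_ge0 U; nia.
(* For D = 16 the second square alone gives only 64, which is not strict. But then t is even and U
   is 2 modulo 4. *)
move=> D17; have U0 : U <> 0.
  have D16' : D = 16 by lia.
  have [r tE] : exists r, t = 2 * r.
    exists (t %/ 2)%Z; have : (t %% 2)%Z = 0 \/ (t %% 2)%Z = 1 by lia.
    case=> r01; first by lia.
    have := divz_eq t 2; rewrite r01; move: (t %/ 2)%Z => r tE.
    by move: D16'; rewrite /D tE; nia.
  by rewrite /U tE => U0; lia.
have : 0 < U ^+ 2 by rewrite exprn_even_gt0//; apply/eqP.
by nia.
Qed.

(* Here disks in neighbouring rows are tangent; a/c is, up to translation, the
   circumcentre of a triangle of the lattice, of circumradius 4 / sqrt 15. *)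
Lemma not_PE2_disc15 : 4 * n - t ^+ 2 = 15 -> exists A : SL2 R, ~ PE2 (class_of A).
Proof.
move=> D15.
have [k tE] : exists k, t = 2 * k + 1.
  exists (t %/ 2)%Z; have : (t %% 2)%Z = 0 \/ (t %% 2)%Z = 1 by lia.
  case=> r01; last by lia.
  have := divz_eq t 2; rewrite r01; move: (t %/ 2)%Z => r tE.
  by move: D15; rewrite tE; nia.
have nE : n = k ^+ 2 + k + 4 by move: D15; rewrite tE; nia.
(* The rows are (a, conj c) and (c, conj a), where c = t - 2 tau is a square root of -15 and N(a) =
   16: the determinant is 16 - 15. *)
have det : qtau (4 + k) (-1) * qtau (4 + k - t) 1 - qtau (- t) 2 * qtau t (-2) = 1.
  by rewrite !(quadM qR) nE tE /quad; ring.
exists (mkSL2 det); have nc : 4 * nm (qtau t (-2)) = 4 * 15.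
  by rewrite quad4E D15; ring.
apply: far_not_PE2.
  by move/(congr1 nm) => c0; move: nc; rewrite c0 nm0.
move=> q; set X := re qR q; set Y := im qR q.
have -> : qtau (4 + k) (-1) - q * qtau t (-2) =
    qtau (4 + k - X * t - 2 * n * Y) (2 * X + t * Y - 1).
  by rewrite {1}(quadE qR q) (quadM qR) /quad -/X -/Y; ring.
have := quad4E (4 + k - X * t - 2 * n * Y) (2 * X + t * Y - 1); rewrite D15.
have -> : 2 * (4 + k - X * t - 2 * n * Y) + t * (2 * X + t * Y - 1) = 7 - 15 * Y.
  by rewrite nE tE; ring.
set N := nm _ => E; set c := nm _ in nc *.
have -> : c = 15 by lia.
(* The sum (7 - 15 Y)^2 + 15 (2 X + t Y - 1)^2 must exceed 60: it is at least 49 + 15 for Y = 0, and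
   at least 8^2 otherwise. *)
have [Y0|Y0] := eqVneq Y 0.
  have : 1 <= (2 * X + t * Y - 1) ^+ 2 by rewrite Y0 mulr0 addr0; nia.
  have : (7 - 15 * Y) ^+ 2 = 49 by rewrite Y0.
  move: E; move: (_ ^+ 2) (_ ^+ 2) => u v; clear; lia.
have : 64 <= (7 - 15 * Y) ^+ 2 by move: Y0; clear; nia.
have := sqr_ge0 (2 * X + t * Y - 1).
by move: E; move: (_ ^+ 2) (_ ^+ 2) => u v; clear; lia.
Qed.

(** Modulo 4, 4 n - t^2 is 0 or 3, so 15 is its only possible value between 12 and 16. *)
Lemma exists_not_PE2 : exists A : SL2 R, ~ PE2 (class_of A).
Proof.
have [_ _ _ D12] := qR.
have [/not_PE2_large_disc//|D16] := leP 16 (4 * n - t ^+ 2).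
apply: not_PE2_disc15.
have [/eqP r0|r0] := boolP ((t %% 2)%Z == 0).
  have [r tE] : exists r, t = 2 * r by exists (t %/ 2)%Z; lia.
  by move: D16 D12; rewrite tE exprMn; move: (r ^+ 2) => u; clear; lia.
have [r tE] : exists r, t = 2 * r + 1 by exists (t %/ 2)%Z; lia.
have : t ^+ 2 = 4 * (r ^+ 2 + r) + 1 by rewrite tE; ring.
by move: D16 D12; move: (t ^+ 2) (r ^+ 2 + r) => u v; clear; lia.
Qed.

Lemma PE2_infinite_index : infinite_index (@PE2 R).
Proof.
have [h nh] := exists_not_PE2.
pose g := class_of (h * translation 3%:~R * h^-1)%g.
apply: (@infinite_index_expg _ _ g); first exact: PE2_subgroup.
move=> k k0 Pk; apply: nh.
apply: (@PE2_of_conj_translation _ _ _ _ qR (3 * k%:Z)); first by lia.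
move: Pk; congr (PE2 _).
elim: k {k0} => [|k IH].
  by rewrite expg0 mulr0 translation0 mulg1 mulgV.
rewrite expgSr IH -class_ofM; congr class_of.
have -> : (3 * k.+1%:Z)%:~R = (3 * k%:Z)%:~R + 3%:~R :> R.
  by rewrite -intrD; congr _%:~R; lia.
by rewrite (translationD (3 * k%:Z)%:~R) !mulgA mulgVK.
Qed.

Lemma PE2_normalizer : normalizer (@PE2 R) = @PE2 R.
Proof.
apply/seteqP; split; last exact/sub_normalizer/PE2_subgroup.
move=> x; rewrite /normalizer/= -[x]repr_class; move: (repr x) => {x} h Nh.
apply: (@PE2_of_conj_translation _ _ _ _ qR 3) => //.
rewrite -Nh; exists (class_of (translation 3%:~R)); first exact: PE2_lower_left0.
by rewrite !class_ofM class_ofV.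
Qed.

End ProperSubgroup.

(** * From an order with its discriminant to a quadratic ring *)

Section ImaginaryQuadratic.
Import passmx.
Variable K : fieldExtType rat.

Lemma in_alg_int (m : int) : (m%:~R : K) = (m%:~R : rat)%:A.
Proof. by rewrite -(rmorph_int (in_alg K)). Qed.

Lemma sqr_alg_neg (d : rat) (w : K) (c : rat) : d < 0 -> w ^+ 2 = d%:A -> w <> c%:A.
Proof.
move=> d0 w2 wc; move: w2; rewrite wc -in_algE -rmorphXn /=.
move/(fmorph_inj (in_alg K)) => cd.
by move: d0; rewrite -cd ltNge sqr_ge0.
Qed.

Lemma imaginary_quadratic_coords : imaginary_quadratic K ->
  exists (d : rat) (w : K), [/\ d < 0, w ^+ 2 = d%:A, \dim {:K} = 2%N
    & forall x, exists p q : rat, x = p%:A + q *: w].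
Proof.
case=> [m [w [m0 w2 full]]]; exists m%:~R, w.
have d0 : (m%:~R : rat) < 0 by rewrite ltrz0.
have wd : w ^+ 2 = (m%:~R : rat)%:A by rewrite w2 in_alg_int.
have deg : adjoin_degree 1 w = 2%N.
  apply/eqP; rewrite eqn_leq; apply/andP; split.
    rewrite -ltnS -size_minPoly.
    have pw : root ('X^2 - (m%:~R : K)%:P) w.
      by rewrite rootE !hornerE w2 subrr.
    have p1 : 'X^2 - (m%:~R : K)%:P \is a polyOver 1%VS.
      by rewrite rpredB ?rpredX ?polyOverX// polyOverC rpred_int.
    have := dvdp_leq _ (minPoly_dvdp p1 pw).
    by rewrite size_XnsubC//; apply; rewrite -size_poly_gt0 size_XnsubC.
  rewrite ltn_neqAle eq_sym adjoin_deg_eq1; apply/andP; split=> //.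
  by apply/negP => /vlineP[c wc]; apply: (sqr_alg_neg d0 wd wc).
split=> //.
  by rewrite -full dim_Fadjoin deg dimv1.
move=> x; have xw : x \in <<1; w>>%VS by rewrite full memvf.
have := Fadjoin_poly_eq xw; have := size_Fadjoin_poly 1 w x.
have /polyOverP := Fadjoin_polyOver 1 w x.
move: (Fadjoin_poly _ _ _) => f f1; rewrite deg => sf.
rewrite (horner_coef_wide _ sf) !big_ord_recl big_ord0 /= addr0 expr0 mulr1 expr1.
have /vlineP[p ->] := f1 0%N; have /vlineP[q ->] := f1 1%N.
by move=> <-; exists p, q; rewrite -scalerAl mul1r.
Qed.

(** An off-diagonal entry of M^2 is b times the trace; if the trace is nonzero then b = 0, and a
    diagonal entry of M^2 is the square of a rational, hence not d. *)
Lemma mxtrace_sq_neg (m : nat) (M : 'M[rat]_m) (d : rat) :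
  m = 2%N -> d < 0 -> M *m M = d%:M -> \tr M = 0.
Proof.
move=> m2; subst m => d0; rewrite (mx2E M) mulmx2 mx2_scalar => E.
have e i j := congr1 (fun A : 'M_2 => A i j) E.
have := e 0 0; have := e 0 1; have := e 1 0; rewrite !mxE /= => e10 e01 e00.
rewrite /mxtrace !big_ord_recl big_ord0 addr0 !mxE /=.
move: (M 0 0) (M 0 1) (M 1 0) (M 1 1) e10 e01 e00 => a b c f e10 e01 e00.
apply/eqP/negPn/negP => af.
have b0 : b = 0 by apply: (mulfI af); rewrite mulr0 -[RHS]e01; ring.
by move: e00; rewrite b0; nra.
Qed.

Lemma field_trace_coords (d : rat) (w : K) (p q : rat) : d < 0 ->
  w ^+ 2 = d%:A -> \dim {:K} = 2%N -> field_trace (p%:A + q *: w) = 2 * p.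
Proof.
move=> d0 w2 dim2; rewrite /field_trace.
have bK := vbasisP {:K}.
pose M := mxof (vbasis {:K}) (vbasis {:K}).
have MD f g : M (f + g) = M f + M g by rewrite /M linearD.
have MZ c f : M (c *: f) = c *: M f by rewrite /M linearZ.
have M1 : M \1%VF = 1%:M by rewrite /M mxof1 ?(basis_free bK).
rewrite -/M !linearD !linearZ /= amull1 MD !MZ M1.
rewrite linearD !linearZ /= mxtrace1.
have -> : \tr (M (amull w)) = 0.
  apply: (mxtrace_sq_neg dim2 d0).
  have ww : (amull w \o amull w)%VF = d *: \1%VF.
    by apply/lfunP => x; rewrite !lfunE /= !lfunE /= mulrA -expr2 w2 -scalerAl mul1r.
  by rewrite /M -mxof_comp// ww -/M MZ M1 scalemx1.
by rewrite dim2 mulr0 addr0 mulrC.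
Qed.

Lemma Zbasis_pair (O : {pred K}) (b : (\dim {:K}).-tuple K) : \dim {:K} = 2%N ->
  is_Zbasis O b -> exists b0 b1 : K,
  [/\ forall x, x \in O <-> exists X Y : int, x = b0 *~ X + b1 *~ Y,
      forall p q : rat, p *: b0 + q *: b1 = 0 -> p = 0 /\ q = 0
    & basis_disc b = field_trace (b0 * b0) * field_trace (b1 * b1)
                     - field_trace (b0 * b1) ^+ 2].
Proof.
rewrite /is_Zbasis /basis_disc; move: (@field_trace K) => T.
move: b; move: (\dim _) => m b m2; subst m => -[/andP[_ fr] bO].
exists (tnth b 0), (tnth b 1); split.
- move=> x; apply: iff_trans (bO x) _; split=> [[c ->]|[X [Y ->]]].
    exists (c 0), (c 1); rewrite !big_ord_recl big_ord0 addr0.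
    by congr (_ + tnth b _ *~ c _); apply: val_inj.
  exists (fun i => if i == 0 then X else Y).
  rewrite !big_ord_recl big_ord0 addr0 /=.
  by congr (_ + tnth b _ *~ _); apply: val_inj.
- move=> p q pq; have /freeP/(_ (fun i => if i == 0 then p else q)) := fr.
  rewrite !big_ord_recl big_ord0 addr0 /= => H.
  have E : forall i : 'I_2, (if i == 0 then p else q) = 0.
    apply: H; rewrite -[RHS]pq !(tnth_nth 0) /=.
    by [].
  by split; [exact: (E 0) | exact: (E 1)].
- rewrite (mx2E (\matrix_(i, j) _)) det_mx2 !mxE.
  by rewrite (mulrC (tnth b 1) (tnth b 0)) expr2.
Qed.

End ImaginaryQuadratic.

(* If g divides both coordinates of 1, then 1/g is in O, so g is a unit. *)
Lemma order_unimodular (K : fieldExtType rat) (O : subringClosed K) (b0 b1 : K) :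
  (forall x, x \in O <-> exists X Y : int, x = b0 *~ X + b1 *~ Y) ->
  (forall p q : rat, p *: b0 + q *: b1 = 0 -> p = 0 /\ q = 0) ->
  exists c0 c1 u v : int, 1 = b0 *~ c0 + b1 *~ c1 /\ u * c0 + v * c1 = 1.
Proof.
move=> bO free; have [c0 [c1 E1]] := (bO 1).1 (rpred1 _).
exists c0, c1; have [u [v uv]] := Bezoutz c0 c1; exists u, v; split=> //.
rewrite uv; set g := gcdz c0 c1.
have /dvdzP[k0 k0E] := dvdz_gcdl c0 c1; have /dvdzP[k1 k1E] := dvdz_gcdr c0 c1.
rewrite -/g in k0E k1E.
pose y := b0 *~ k0 + b1 *~ k1.
have yg : y *~ g = 1 by rewrite E1 k0E k1E /y mulrzDl -!mulrzA.
have yO : y \in O by apply/bO; exists k0, k1.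
have b0O : b0 \in O by apply/bO; exists 1, 0; rewrite mulr0z addr0.
(* Multiplying y b0 = X b0 + Y b1 by g, the inverse of y, and comparing coordinates gives g X =
   1. *)
have [X [Y E]] := (bO _).1 (rpredM yO b0O).
have : ((g * X - 1)%:~R : rat) *: b0 + ((g * Y)%:~R : rat) *: b1 = 0.
  rewrite !scaler_int -[b0 *~ _]mulrzl -[b1 *~ _]mulrzl.
  have -> : (g * X - 1)%:~R * b0 + (g * Y)%:~R * b1 =
      g%:~R * (X%:~R * b0 + Y%:~R * b1) - b0 by ring.
  by rewrite !mulrzl -E -mulrzAl yg mul1r subrr.
move/free => [/eqP + _]; rewrite intr_eq0 subr_eq0 => /eqP gX.
have : 0 <= g by [].
move: (g) gX => {g k0E k1E yg} g gX g0.
have X0 : 0 < X by rewrite ltNge; apply/negP => ?; nia.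
by nia.
Qed.

(** The vector 1 is completed to a Z-basis 1, [tau] by a change of basis of determinant 1, so t^2 -
    4 n is the given discriminant. *)
Lemma order_quadratic_ring (K : fieldExtType rat) (O : subringClosed K) (Delta : rat) :
  imaginary_quadratic K -> has_disc O Delta -> 12 < `|Delta| ->
  exists (tau : order_ring O) (t n : int), quadratic_ring tau t n.
Proof.
move=> /imaginary_quadratic_coords[d [w [d0 w2 dim2 coords]]] [b [bO ->]].
have [b0 [b1 [{}bO free ->]]] := Zbasis_pair dim2 bO.
have [c0 [c1 [u [v [one uv]]]]] := order_unimodular bO free.
(* An abstract ring morphism in place of scaling, so that [ring] can compute with coordinates. *)
have [i iE] : exists i : {rmorphism rat -> K}, forall p, i p = p%:A by exists (in_alg K).
have cE p q : p%:A + q *: w = i p + i q * w by rewrite !iE mulr_algl.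
have Tr p q : field_trace (i p + i q * w) = 2 * p.
  by rewrite -cE (field_trace_coords p q d0 w2 dim2).
have w2i : w ^+ 2 = i d by rewrite w2 iE.
have mulw p q p' q' : (i p + i q * w) * (i p' + i q' * w) =
    i (p * p' + d * q * q') + i (p * q' + q * p') * w.
  have -> : (i p + i q * w) * (i p' + i q' * w) =
    i p * i p' + i q * i q' * w ^+ 2 + (i p * i q' + i q * i p') * w by ring.
  by rewrite w2i; ring.
have indep p q p' q' : i p + i q * w = i p' + i q' * w -> p = p' /\ q = q'.
  move=> E; have {}E : i (q - q') * w = i (p' - p).
    apply/eqP; rewrite -subr_eq0.
    have -> : i (q - q') * w - i (p' - p) = (i p + i q * w) - (i p' + i q' * w) by ring.
    by rewrite E subrr.
  have qq : q = q'.
    apply/eqP; rewrite -subr_eq0; apply/negPn/negP => qq.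
    apply: (@sqr_alg_neg _ d w ((q - q')^-1 * (p' - p))) => //.
    by rewrite -iE rmorphM -E mulrA -rmorphM mulVf// rmorph1 mul1r.
  split=> //; move/eqP: E; rewrite qq subrr rmorph0 mul0r eq_sym fmorph_eq0.
  by rewrite subr_eq0 => /eqP.
have [p0 [q0]] := coords b0; have [p1 [q1]] := coords b1; rewrite !cE => E1 E0.
(* In the basis b0, b1 the coordinates of 1 and [tau] are (c0, c1) and (-v, u), of determinant u c0
   + v c1 = 1. *)
have [tau tauD] : exists tau, tau = u%:~R * b1 - v%:~R * b0 by eexists.
have tauO : tau \in O.
  apply/bO; exists (- v), u; rewrite tauD -[b0 *~ _]mulrzl -[b1 *~ _]mulrzl; ring.
have oneb : c0%:~R * b0 + c1%:~R * b1 = 1 by rewrite !mulrzl -one.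
have uvK : u%:~R * c0%:~R + v%:~R * c1%:~R = 1 :> K by rewrite -!intrM -intrD uv.
have b0E : b0 = u%:~R - c1%:~R * tau.
  transitivity (u%:~R * (c0%:~R * b0 + c1%:~R * b1) - c1%:~R * tau).
    by rewrite -[LHS]mul1r -[in LHS]uvK tauD; ring.
  by rewrite oneb mulr1.
have b1E : b1 = v%:~R + c0%:~R * tau.
  transitivity (v%:~R * (c0%:~R * b0 + c1%:~R * b1) + c0%:~R * tau).
    by rewrite -[LHS]mul1r -[in LHS]uvK tauD; ring.
  by rewrite oneb mulr1.
have OE x : x \in O -> exists X Y : int, x = X%:~R + Y%:~R * tau.
  move=> /bO[X [Y ->]]; exists (X * u + Y * v), (Y * c0 - X * c1).
  by rewrite -[b0 *~ _]mulrzl -[b1 *~ _]mulrzl [in LHS]b0E [in LHS]b1E; ring.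
pose p := u%:~R * p1 - v%:~R * p0; pose q := u%:~R * q1 - v%:~R * q0.
have tauw : tau = i p + i q * w by rewrite tauD E0 E1 /p /q; ring.
have [n' [t tau2]] := OE _ (rpredX 2 tauO).
have [nE tE] : p * p + d * q * q = n'%:~R + t%:~R * p /\ p * q + q * p = t%:~R * q.
  by apply: indep; rewrite -mulw -tauw -expr2 tau2 tauw; ring.
have [cp cq] : c0%:~R * p0 + c1%:~R * p1 = 1 /\ c0%:~R * q0 + c1%:~R * q1 = 0.
  by apply: indep; rewrite rmorph1 rmorph0 mul0r addr0 -oneb E0 E1; ring.
have uvQ : u%:~R * c0%:~R + v%:~R * c1%:~R = 1 :> rat by rewrite -!intrM -intrD uv.
have qE : q = p0 * q1 - p1 * q0.
  rewrite -[LHS]mulr1 -[RHS]mul1r -[in LHS]cp -[in RHS]uvQ.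
  apply/eqP; rewrite -subr_eq0; apply/eqP.
  transitivity ((u%:~R * p1 - v%:~R * p0) * (c0%:~R * q0 + c1%:~R * q1)).
    by rewrite /q; ring.
  by rewrite cq mulr0.
rewrite E0 E1 !mulw !Tr.
have -> : 2 * (p0 * p0 + d * q0 * q0) * (2 * (p1 * p1 + d * q1 * q1))
    - (2 * (p0 * p1 + d * q0 * q1)) ^+ 2 = 4 * d * q ^+ 2 by rewrite qE; ring.
move=> large.
have q_neq0 : q != 0.
  by apply/eqP => q_eq0; move: large; rewrite q_eq0 expr0n mulr0 normr0.
(* The w-coordinates of tau^2 = n' + t tau give 2 p q = t q. *)
have tp : t%:~R = 2 * p by apply: (mulIf q_neq0); rewrite -tE; ring.
pose T : order_ring O := Sub tau tauO.
have valq X Y : val (quad T X Y) = X%:~R + Y%:~R * tau.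
  by rewrite /quad rmorphD rmorphM !rmorph_int.
exists T, t, (- n'); split.
- by apply: val_inj; rewrite valq opprK rmorphXn.
- by move=> x; have [X [Y E]] := OE _ (valP x); exists X, Y; apply: val_inj; rewrite valq.
- move=> X Y /(congr1 val); rewrite valq tauw rmorph0 => XY.
  have [XE /eqP] : X%:~R + Y%:~R * p = 0 /\ Y%:~R * q = 0.
    by apply: indep; rewrite rmorph0 mul0r addr0 -[RHS]XY; ring.
  rewrite mulf_eq0 (negPf q_neq0) orbF intr_eq0 => /eqP Y0.
  by move: XE; rewrite Y0 mul0r addr0 => /eqP; rewrite intr_eq0 => /eqP.
- rewrite -(ltr_int rat).
  have -> : (4 * - n' - t ^+ 2)%:~R = - (4 * d * q ^+ 2).
    have nE' : n'%:~R = d * q * q - p * p.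
      have -> : n'%:~R = p * p + d * q * q - t%:~R * p by rewrite nE addrK.
      by rewrite tp; ring.
    have -> : (4 * - n' - t ^+ 2)%:~R = - (4 * n'%:~R) - t%:~R ^+ 2 :> rat by ring.
    by rewrite nE' tp; ring.
  rewrite -ler0_norm// -mulrA pmulr_rle0// mulr_le0_ge0 ?sqr_ge0//.
  exact: ltW.
Qed.

Theorem corollary1p3 (K : fieldExtType rat) (hK : imaginary_quadratic K)
  (O : subringClosed K) (hO : is_order O)
  (Delta : rat) (hDelta : has_disc O Delta) (hlarge : 12 < `|Delta|) :
  [/\ is_subgroup (@PE2 (order_ring O)),
      infinite_index (@PE2 (order_ring O))
    & normalizer (@PE2 (order_ring O)) = @PE2 (order_ring O)].
Proof.
have [tau [t [n qR]]] := order_quadratic_ring hK hDelta hlarge.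
split; [exact: PE2_subgroup | exact: PE2_infinite_index qR | exact: PE2_normalizer qR].
Qed.
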